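(* Let $X$ be an infinite-dimensional separable Banach space of analytic functions on $\mathbb{D}$ such that: (1) $H^\infty$ is dense in $X$ (in particular $H^\infty\subset X$); and (2) for every analytic self-map $\psi:\mathbb{D}\to\mathbb{D}$ and every $u\in H^\infty$, the weighted composition operator $C_{u,\psi}$ is a bounded operator on $X$ and $\|(C_{u,\psi})^n f\|_X\le \|u^{(n)}\|_X\,\|f\|_\infty$ for all $f\in H^\infty$ and all $n\in\mathbb{N}$. Let $\varphi:\mathbb{D}\to\mathbb{D}$ be an analytic self-map and $w\in H^\infty$. If $$\liminf_{n\to\infty}\|w^{(n)}\|_X=0,$$ then the following assertions are equivalent: (i) $C_{w,\varphi}$ is densely Li--Yorke chaotic on $X$; (ii) $C_{w,\varphi}$ has a residual set of irregular vectors in $X$; (iii) $C_{w,\varphi}$ is not power-bounded on $X$.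
   Context: $\mathbb{D}$ is the open unit disk in $\mathbb{C}$, $\mathbb{N}=\{1,2,\dots\}$. $H^\infty$ is the space of bounded analytic functions on $\mathbb{D}$ with $\|f\|_\infty=\sup_{z\in\mathbb{D}}|f(z)|$. For an analytic self-map $\varphi$ of $\mathbb{D}$ and $w\in H^\infty$, the weighted composition operator is $C_{w,\varphi}f=w\cdot(f\circ\varphi)$; $\varphi^n$ denotes the $n$-fold iterate of $\varphi$; and $w^{(1)}=w$, $w^{(n)}=(w\circ\varphi^{n-1})\cdots(w\circ\varphi)\cdot w$ for $n\ge2$ (so $w^{(n)}$ depends on $\varphi$ too; $u^{(n)}$ is formed with $\psi$ in the same way), so that $(C_{w,\varphi})^nf=w^{(n)}\cdot(f\circ\varphi^n)$. Let $T$ be a bounded operator on a Banach space $X$. $T$ is Li--Yorke chaotic if there is an uncountable set $S\subset X$ (a scrambled set) such that for all distinct $x,y\in S$, $\liminf_{n\to\infty}\|T^nx-T^ny\|=0$ and $\limsup_{n\to\infty}\|T^nx-T^ny\|>0$; it is densely Li--Yorke chaotic if $S$ can be chosen dense in $X$. A vector $x$ is irregular for $T$ if $\liminf_{n\to\infty}\|T^nx\|=0$ and $\limsup_{n\to\infty}\|T^nx\|=\infty$. $T$ is power-bounded if $\sup_{n\in\mathbb{N}}\|T^n\|<\infty$. A subset of $X$ is residual if its complement is of first category (meager). *)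

(* Defs.v *)
From HB Require Import structures.
From mathcomp Require Import all_boot all_order all_algebra.
From mathcomp Require Import all_classical all_reals all_analysis.
From mathcomp Require Import complex.

Set Implicit Arguments.
Unset Strict Implicit.
Unset Printing Implicit Defensive.

Import Order.TTheory GRing.Theory Num.Theory.
Import numFieldNormedType.Exports.

Local Open Scope classical_set_scope.
Local Open Scope ring_scope.

(* The field of complex numbers is R[i], for an arbitrary R : realType.  The
   norm of a normedModType over R[i] takes its values in R[i]; being nonnegative
   they are real, and [rnorm] is the same norm seen as an element of R. *)
Definition rnorm (R : realType) (V : normedModType R[i]) (v : V) : R :=
  complex.Re `|v|.

Section TopologicalNotions.
Variable T : topologicalType.

Definition separable : Prop := exists2 A : set T, countable A & dense A.

Definition nowhere_dense (A : set T) : Prop := (closure A)° = set0.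

Definition meager (A : set T) : Prop :=
  exists2 F : nat -> set T,
    forall n, nowhere_dense (F n) & A = \bigcup_n F n.

Definition residual (A : set T) : Prop := meager (~` A).

End TopologicalNotions.

Definition finite_dimensional (K : numFieldType) (V : lmodType K) : Prop :=
  exists (n : nat) (e : 'I_n -> V),
    forall x : V, exists a : 'I_n -> K, x = \sum_(i < n) a i *: e i.

Section Operators.
Variables (R : realType) (X : normedModType R[i]).
Implicit Types (T : X -> X) (S : set X) (x : X).

Definition opnorm T : \bar R :=
  ereal_sup [set (rnorm (T x))%:E | x in [set x | rnorm x <= 1]].

Definition bounded_operator T : Prop := linear T /\ (opnorm T < +oo)%E.

Definition power_bounded T : Prop :=
  (ereal_sup [set opnorm (iter n T) | n in [set n | (0 < n)%N]] < +oo)%E.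

Definition scrambled T S : Prop :=
  ~ countable S /\
  forall x y, S x -> S y -> x <> y ->
    limn_einf (fun n => (rnorm (iter n T x - iter n T y))%:E) = 0%E /\
    (0 < limn_esup (fun n => (rnorm (iter n T x - iter n T y))%:E))%E.

Definition densely_Li_Yorke_chaotic T : Prop :=
  exists2 S : set X, scrambled T S & dense S.

Definition irregular T x : Prop :=
  limn_einf (fun n => (rnorm (iter n T x))%:E) = 0%E /\
  limn_esup (fun n => (rnorm (iter n T x))%:E) = +oo%E.

End Operators.

(* Functions on the unit disk are represented by total functions on R[i] whose
   values outside the disk are irrelevant. *)
Section FunctionsOnTheDisk.
Variable R : realType.
Implicit Types (f g u w phi psi : R[i] -> R[i]).

Definition unit_disk : set R[i] := [set z | `|z| < 1].

Definition eq_on_disk f g : Prop := forall z, unit_disk z -> f z = g z.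

(* [derivable] is taken over the field R[i], so this is complex
   differentiability at every point of the (open) disk. *)
Definition analytic_on_disk f : Prop :=
  forall z, unit_disk z -> derivable (f : R[i]^o -> R[i]^o) z 1.

Definition Hinf f : Prop :=
  analytic_on_disk f /\
  exists M : R, forall z, unit_disk z -> rnorm (f z : R[i]^o) <= M.

(* The supremum norm; meaningful for f bounded on the disk. *)
Definition sup_norm f : R := sup [set rnorm (f z : R[i]^o) | z in unit_disk].

Definition analytic_self_map psi : Prop :=
  analytic_on_disk psi /\ forall z, unit_disk z -> unit_disk (psi z).

Definition weighted_comp u psi f : R[i] -> R[i] := fun z => u z * f (psi z).

(* u^(n) = (u \o psi^(n-1)) * ... * (u \o psi) * u *)
Definition weight_iter u psi (n : nat) : R[i] -> R[i] :=
  fun z => \prod_(k < n) u (iter k psi z).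

End FunctionsOnTheDisk.

(* A Banach space of analytic functions on the disk is a complete normed space
   X together with a map ev sending each element of X to the function that it
   is: ev is linear and injective, up to equality on the disk. *)
Section FunctionSpaces.
Variables (R : realType) (X : completeNormedModType R[i]).
Variable ev : X -> R[i] -> R[i].

Definition space_of_analytic_functions : Prop :=
  [/\ forall (a : R[i]) (x y : X) (z : R[i]), unit_disk z ->
        ev (a *: x + y) z = a * ev x z + ev y z,
      forall x y : X, eq_on_disk (ev x) (ev y) -> x = y
    & forall x : X, analytic_on_disk (ev x)].

Definition in_space (f : R[i] -> R[i]) : Prop :=
  exists x : X, eq_on_disk (ev x) f.

(* The function f as an element of X; 0 is a dummy value when f is not in X. *)
Definition elt (f : R[i] -> R[i]) : X :=
  xget 0 [set x | eq_on_disk (ev x) f].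

(* C_{u,psi} on X; meaningful when C_{u,psi} maps X into itself. *)
Definition weighted_comp_op (u psi : R[i] -> R[i]) : X -> X :=
  fun x => elt (weighted_comp u psi (ev x)).

End FunctionSpaces.

(* Main.v *)
(* Put b_n = ||w^(n)||_X, so that T = C_{w,phi} satisfies ||T^n f|| <= C_f b_n
   for f in the dense set H^oo, and b_n is small along one subsequence that
   serves all f.  If T is power-bounded, T^n x therefore tends to 0 for every x,
   so no scrambled pair exists.  If not, Banach-Steinhaus makes unbounded orbits
   generic, while density of H^oo makes "b_n + ||T^n x|| has liminf 0" generic;
   this gives a residual set of irregular vectors.  One x0 with both properties
   yields a dense scrambled set inside H^oo + R x0: there all orbits have
   liminf 0, along a common subsequence, and on each line of direction x0 at most
   one point has a bounded orbit. *)
Require Import Defs.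
From HB Require Import structures.
From mathcomp Require Import all_boot all_order all_algebra.
From mathcomp Require Import all_classical all_reals all_analysis.
From mathcomp Require Import complex.
From mathcomp Require Import ring lra.

Set Implicit Arguments.
Unset Strict Implicit.
Unset Printing Implicit Defensive.

Import Order.TTheory GRing.Theory Num.Theory.
Import numFieldNormedType.Exports.

Local Open Scope classical_set_scope.
Local Open Scope ring_scope.

(** * Lower and upper limits of real sequences, in epsilon form *)

Section LimInfSup.
Variable R : realType.
Implicit Types u : nat -> R.

(** The lower limit is the supremum of the tail infima. These are nonnegative here, so it is 0
    exactly when each tail infimum is 0. *)
Lemma limn_einf0P u : (forall n, 0 <= u n) ->
  limn_einf (fun n => (u n)%:E) = 0%E <->
  forall e N, 0 < e -> exists2 n, (N <= n)%N & u n < e.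
Proof.
move=> u0.
have -> : limn_einf (fun n => (u n)%:E) =
          ereal_sup (range (einfs (fun n => (u n)%:E))).
  by rewrite limn_einf_lim; apply/cvg_lim => //; exact: cvg_einfs_sup.
split=> [supE e N e0|small].
  have : (einfs (fun n => (u n)%:E) N < e%:E)%E.
    by rewrite (@le_lt_trans _ _ 0%E)// -supE; apply: ereal_sup_ubound; exists N.
  by move=> /ereal_inf_lt[_ [n /= Nn <-]]; rewrite lte_fin; exists n.
apply/eqP; rewrite eq_le; apply/andP; split.
  apply: ge_ereal_sup => _ [N _ <-]; apply/lee_addgt0Pr => e e0.
  rewrite add0e; have [n Nn une] := small _ N e0.
  apply: (@le_trans _ _ (u n)%:E); last by rewrite lee_fin ltW.
  by apply: ereal_inf_lbound; exists n.
apply: (@le_trans _ _ (einfs (fun n => (u n)%:E) 0%N)).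
  by apply: le_ereal_inf_tmp => _ [n _ <-]; rewrite lee_fin.
by apply: ereal_sup_ubound; exists 0%N.
Qed.

Lemma limn_esup_inf u :
  limn_esup (fun n => (u n)%:E) = ereal_inf (range (esups (fun n => (u n)%:E))).
Proof. by rewrite limn_esup_lim; apply/cvg_lim => //; exact: cvg_esups_inf. Qed.

Lemma unbounded_limn_esup u : (forall M, exists n, M < u n) ->
  limn_esup (fun n => (u n)%:E) = +oo%E.
Proof.
move=> unb; rewrite limn_esup_inf.
apply/eqP; rewrite -leye_eq; apply: le_ereal_inf_tmp => _ [N _ <-].
rewrite leye_eq; apply/eqP/eqyP => A A0.
(* The sum dominates each of the first N terms, so a term exceeding it has index at least N and
   counts in the tail supremum. *)
have [n ltn] := unb (\sum_(k < N) `|u k| + `|A|).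
have sum0 : 0 <= \sum_(k < N) `|u k| by apply: sumr_ge0.
apply: (@le_trans _ _ (u n)%:E).
  by rewrite lee_fin; have := ler_norm A; lra.
apply: ereal_sup_ubound; exists n => //=; rewrite leqNgt; apply/negP => nN.
have : `|u n| <= \sum_(k < N) `|u k|.
  by rewrite (bigD1 (Ordinal nN))//= lerDl sumr_ge0.
by have := ler_norm (u n); have := normr_ge0 A; lra.
Qed.

Lemma limn_esupy_unbounded u : limn_esup (fun n => (u n)%:E) = +oo%E ->
  forall M, exists n, M < u n.
Proof.
move=> + M; apply: contraPP => /forallNP leM; rewrite limn_esup_inf => infy.
have : (+oo <= M%:E)%E.
  rewrite -infy (@le_trans _ _ (esups (fun n => (u n)%:E) 0%N))//.
    by apply: ereal_inf_lbound; exists 0%N.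
  apply: ge_ereal_sup => _ [n _ <-]; rewrite lee_fin leNgt.
  exact/negP/leM.
by rewrite leye_eq.
Qed.

Lemma limn_esup_le0 u :
  (forall e, 0 < e -> exists N, forall n, (N <= n)%N -> u n <= e) ->
  (limn_esup (fun n => (u n)%:E) <= 0)%E.
Proof.
move=> small; rewrite limn_esup_inf; apply/lee_addgt0Pr => e e0.
rewrite add0e; have [N uN] := small _ e0.
apply: (@le_trans _ _ (esups (fun n => (u n)%:E) N)).
  by apply: ereal_inf_lbound; exists N.
by apply: ge_ereal_sup => _ [n /= Nn <-]; rewrite lee_fin uN.
Qed.

End LimInfSup.

(** * The real-valued norm, density and Baire category *)

Section RealNorm.
Local Open Scope complex_scope.
Variables (R : realType) (X : normedModType R[i]).
Implicit Types (x y v : X) (A B F : set X).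

Lemma rnormE v : `|v| = (rnorm v)%:C.
Proof. by rewrite /rnorm RRe_real// normr_real. Qed.

Lemma rnorm_ge0 v : 0 <= rnorm v.
Proof. by rewrite -ler0c -rnormE. Qed.

Lemma rnorm0 : rnorm (0 : X) = 0.
Proof. by rewrite /rnorm normr0. Qed.

Lemma rnormN v : rnorm (- v) = rnorm v.
Proof. by rewrite /rnorm normrN. Qed.

Lemma rnormD x y : rnorm (x + y) <= rnorm x + rnorm y.
Proof. by rewrite -lecR rmorphD /= -!rnormE ler_normD. Qed.

Lemma rnormB x y : rnorm (x - y) <= rnorm x + rnorm y.
Proof. by rewrite -(rnormN y) rnormD. Qed.

Lemma rnormBC x y : rnorm (x - y) = rnorm (y - x).
Proof. by rewrite -rnormN opprB. Qed.

Lemma rnormZ (t : R) v : rnorm (t%:C *: v) = `|t| * rnorm v.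
Proof.
apply/complexI; rewrite -rnormE rmorphM /= -rnormE normrZ normc_def /=.
by rewrite expr0n addr0 sqrtr_sqr.
Qed.

Lemma rnorm_eq0 v : rnorm v = 0 -> v = 0.
Proof. by move=> v0; apply/normr0_eq0; rewrite rnormE v0. Qed.

Lemma nbhs_rnormP x A :
  nbhs x A <-> exists2 e : R, 0 < e & forall y, rnorm (x - y) < e -> A y.
Proof.
split=> [/nbhs_ballP[e /= e0]|[e e0 eA]].
  rewrite -ball_normE => eA.
  have eE : e = (complex.Re e)%:C%C by rewrite RRe_real// gtr0_real.
  exists (complex.Re e); first by rewrite -ltcR -eE.
  by move=> y xy; apply: eA; rewrite /= eE rnormE ltcR.
apply/nbhs_ballP; exists e%:C; first by rewrite /= ltcR.
by rewrite -ball_normE => y /=; rewrite rnormE ltcR => /eA.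
Qed.

Lemma dense_rnormP A :
  dense A <-> forall x (e : R), 0 < e -> exists2 y, A y & rnorm (x - y) < e.
Proof.
split=> [dA x e e0|dA U [x Ux] oU].
  have [|y [/interior_subset /= xy Ay]] := dA _ _ (open_interior [set y | rnorm (x - y) < e]).
    exists x; apply/nbhs_rnormP; exists e => //.
  by exists y.
have /nbhs_rnormP[e e0 eU] : nbhs x U by apply: open_nbhs_nbhs.
by have [y Ay /eU Uy] := dA x e e0; exists y.
Qed.

(** The form in which category arguments are run: inside any ball one can move to a smaller ball
    that misses [F]. *)
Lemma nowhere_denseP F :
  nowhere_dense F <->
  forall x (e : R), 0 < e -> exists y s,
    [/\ 0 < s, rnorm (x - y) < e & forall z, rnorm (y - z) < s -> ~ F z].
Proof.
split=> [F0 x e e0|avoid].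
  have : ~ (closure F)° x by rewrite F0.
  move=> /nbhs_rnormP/forall2NP/(_ e)[//|/existsNP[y /not_implyP[xy]]].
  rewrite -[closure F]setCK -interiorC => /contrapT/nbhs_rnormP[s s0 sF].
  by exists y, s.
rewrite /nowhere_dense -subset0 => x /nbhs_rnormP[e e0 eF].
have [y [s [s0 /eF + sF]]] := avoid x e e0.
rewrite -[closure F]setCK -interiorC; apply.
by apply/nbhs_rnormP; exists s.
Qed.

Lemma residual_bigcap A (G : nat -> set X) :
  (forall n, nowhere_dense (~` G n)) -> \bigcap_n G n `<=` A -> residual A.
Proof.
move=> G0 GA; exists (fun n => ~` G n `&` ~` A) => [n|].
  apply/nowhere_denseP => x e /(proj1 (nowhere_denseP _) (G0 n) x)[y [s [? ? sG]]].
  by exists y, s; split => // z /sG Gz [].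
rewrite -setI_bigcupl -setC_bigcap setIidr//; exact: subsetC.
Qed.

Lemma residual_sub A B : residual A -> A `<=` B -> residual B.
Proof.
move=> [F F0 AF] AB; apply: (@residual_bigcap _ (fun n => ~` F n)) => [n|].
  by rewrite setCK.
by rewrite -setC_bigcup -AF setCK.
Qed.

End RealNorm.

(* The library's Baire theorem is restricted to modules over a real field. *)
Lemma residual_nonempty (R : realType) (X : completeNormedModType R[i])
  (A : set X) : residual A -> A !=set0.
Proof.
move=> [F F0 AF].
(* A pair is the centre and radius of a closed ball; [q] is a smaller ball inside [p] that misses
   [F n]. Positivity of the radius is assumed after [q] is chosen, so that [choice] yields a total
   function. *)
have step (n : nat) (p : X * R) : exists q : X * R, 0 < p.2 ->
    [/\ 0 < q.2, q.2 < n.+1%:R^-1 & forall z, rnorm (q.1 - z) <= q.2 ->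
      rnorm (p.1 - z) <= p.2 /\ ~ F n z].
  have [p0|] := boolP (0 < p.2); last by exists p.
  have [y [s [s0 py sF]]] := proj1 (nowhere_denseP _) (F0 n) p.1 p.2 p0.
  have := invr_gt0 (n.+1%:R : R); rewrite ltr0n; set d := n.+1%:R^-1 => d0.
  (* The three bounds keep the closed ball off [F n], inside the ball [p], and of radius below
     1/(n+1). *)
  pose r := Num.min (s / 2) (Num.min (p.2 - rnorm (p.1 - y)) (d / 2)).
  have r0 : 0 < r by rewrite /r !lt_min subr_gt0 py !divr_gt0.
  have [r1 r2 r3] : [/\ r <= s / 2, r <= p.2 - rnorm (p.1 - y) &
      r <= d / 2] by rewrite /r !ge_min !lexx !orbT.
  exists (y, r) => _; split => //=; first by lra.
  move=> z yz; split; last by apply: sF; lra.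
  by rewrite -(subrKA y) (le_trans (rnormD _ _))//; lra.
have [f fP] := choice (fun np => step np.1 np.2).
pose p := fix p n := if n is m.+1 then f (m, p m) else (0 : X, 1 : R).
have p0 n : 0 < (p n).2 by elim: n => //= n /(fP (n, p n))[].
have pS n : (p n.+1).2 < n.+1%:R^-1 by have [] := fP (n, p n) (p0 n).
have pF n z : rnorm ((p n.+1).1 - z) <= (p n.+1).2 ->
    rnorm ((p n).1 - z) <= (p n).2 /\ ~ F n z.
  by have [_ _] := fP (n, p n) (p0 n); apply.
have nested k n z : rnorm ((p (k + n)%N).1 - z) <= (p (k + n)%N).2 ->
    rnorm ((p n).1 - z) <= (p n).2.
  by elim: k => //= k IH /pF[/IH].
have near_p n m : (n <= m)%N -> rnorm ((p n).1 - (p m).1) <= (p n).2.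
  by move=> nm; apply: (nested (m - n)%N); rewrite subnK// subrr rnorm0 ltW.
have pcvg : cvgn (fun n => (p n).1).
  apply: cauchy_cvg; apply: cauchy_exP => e /= e0.
  have eE : e = (complex.Re e)%:C%C by rewrite RRe_real// gtr0_real.
  have {}e0 : 0 < complex.Re e by rewrite -ltcR -eE.
  have [N eN] := ltr_add_invr e0; rewrite add0r in eN.
  exists (p N.+1).1; exists N.+1 => // n /= Nn.
  rewrite /= -ball_normE /= eE rnormE ltcR.
  by rewrite (le_lt_trans (near_p _ _ Nn))// (lt_trans (pS N)).
have [l pl] := proj1 (cvg_ex _) pcvg.
exists l; apply: contrapT => Al; have : (~` A) l by [].
rewrite AF => -[n _]; apply: (proj2 (pF n l _)).
(* If the limit were at positive distance [d] from a closed ball of the chain, a late centre closer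
   than [d] to the limit would lie outside that ball, against nesting. *)
rewrite leNgt; apply/negP => ltl.
set d := rnorm ((p n.+1).1 - l) - (p n.+1).2.
have d0 : 0 < d by rewrite subr_gt0.
have /pl[N _ Nl] : nbhs l [set y | rnorm (l - y) < d].
  by apply/nbhs_rnormP; exists d.
have /= := Nl (maxn N n.+1) (leq_maxl _ _).
have := near_p _ _ (leq_maxr N n.+1).
have := rnormD ((p n.+1).1 - (p (maxn N n.+1)).1) ((p (maxn N n.+1)).1 - l).
by rewrite subrKA (rnormBC l) /d; lra.
Qed.

(** * Orbits of a linear operator: boundedness, domination, irregularity *)

Section Orbits.
Local Open Scope complex_scope.
Variables (R : realType) (X : normedModType R[i]).
Implicit Types (S : X -> X) (x y u v : X) (b : nat -> R) (s t e M : R).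

Lemma linear_rnorm_le S M : linear S -> (opnorm S <= M%:E)%E ->
  forall x, rnorm (S x) <= M * rnorm x.
Proof.
move=> linS SM x; have [/eqP x0|x0] := boolP (rnorm x == 0).
  rewrite x0 mulr0 (rnorm_eq0 x0) -(subrr x) (zmod_morphism_linear linS).
  by rewrite subrr rnorm0.
have {}x0 : 0 < rnorm x by rewrite lt_neqAle eq_sym x0 rnorm_ge0.
have -> : S x = (rnorm x)%:C *: S ((rnorm x)^-1%:C *: x).
  by rewrite -(scalable_linear linS) scalerA -rmorphM /= divff ?gt_eqF// scale1r.
rewrite rnormZ gtr0_norm// mulrC.
apply: ler_wpM2r; first exact: ltW.
rewrite -lee_fin (le_trans _ SM)//; apply: ereal_sup_ubound.
exists ((rnorm x)^-1%:C *: x) => //=.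
by rewrite rnormZ gtr0_norm ?invr_gt0// mulVf ?gt_eqF.
Qed.

Lemma opnorm_le S M : 0 <= M -> (forall x, rnorm (S x) <= M * rnorm x) ->
  (opnorm S <= M%:E)%E.
Proof.
move=> M0 SM; apply: ge_ereal_sup => _ [x /= x1 <-]; rewrite lee_fin.
by rewrite (le_trans (SM x))// ler_piMr.
Qed.

Lemma lty_le_fin (x : \bar R) : (x < +oo)%E -> exists2 M, 0 <= M & (x <= M%:E)%E.
Proof.
case: x => [r| |]// _; last by exists 0 => //; rewrite leNye.
by exists `|r| => //; rewrite lee_fin ler_norm.
Qed.

Variable T : X -> X.
Hypothesis linT : linear T.

Lemma iter_linear n : linear (iter n T).
Proof. by elim: n => // n IH a x y /=; rewrite IH linT. Qed.

Lemma iter_scale n (c : R[i]) x : iter n T (c *: x) = c *: iter n T x.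
Proof. exact: (scalable_linear (iter_linear n)). Qed.

Lemma iter_sub n x y : iter n T (x - y) = iter n T x - iter n T y.
Proof. exact: (zmod_morphism_linear (iter_linear n)). Qed.

Lemma iter_add n x y : iter n T (x + y) = iter n T x + iter n T y.
Proof. by have := iter_linear n 1 x y; rewrite !scale1r. Qed.

Lemma power_boundedP :
  power_bounded T <-> exists M, forall n x, rnorm (iter n T x) <= M * rnorm x.
Proof.
split=> [/lty_le_fin[M M0 supM]|[M TM]].
  (* The supremum in [power_bounded] starts at n = 1; adding 1 also covers the identity, n = 0. *)
  exists (M + 1) => -[|n] x.
    by rewrite /= mulrDl mul1r lerDr mulr_ge0// rnorm_ge0.
  apply: (@le_trans _ _ (M * rnorm x)).
    apply: linear_rnorm_le; first exact: iter_linear.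
    by apply: le_trans supM; apply: ereal_sup_ubound; exists n.+1.
  by rewrite ler_wpM2r ?rnorm_ge0// lerDl.
apply: (@le_lt_trans _ _ `|M|%:E); last exact: ltry.
apply: ge_ereal_sup => _ [n _ <-]; apply: opnorm_le => // x.
by rewrite (le_trans (TM n x))// ler_wpM2r ?rnorm_ge0// ler_norm.
Qed.

Definition bounded_orbit x := exists M, forall n, rnorm (iter n T x) <= M.

Lemma bounded_orbit0 : bounded_orbit 0.
Proof. by exists 0 => n; rewrite -(scale0r 0) iter_scale scale0r rnorm0. Qed.

Lemma bounded_orbitB x y :
  bounded_orbit x -> bounded_orbit y -> bounded_orbit (x - y).
Proof.
move=> [M xM] [N yN]; exists (M + N) => n.
by rewrite iter_sub (le_trans (rnormB _ _))// lerD.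
Qed.

Lemma bounded_orbitZ t x : bounded_orbit x -> bounded_orbit (t%:C *: x).
Proof.
by move=> [M xM]; exists (`|t| * M) => n; rewrite iter_scale rnormZ ler_wpM2l.
Qed.

(** The two points differ by (s - t) x, and vectors with bounded orbit are closed under differences
    and real multiples; s <> t would therefore bound the orbit of [x]. *)
Lemma bounded_orbit_line u x s t : ~ bounded_orbit x ->
  bounded_orbit (u + s%:C *: x) -> bounded_orbit (u + t%:C *: x) -> s = t.
Proof.
move=> xN bs bt; apply/eqP; rewrite -subr_eq0; apply: contrapT => /negP st.
apply: xN; have := bounded_orbitZ (s - t)^-1 (bounded_orbitB bs bt).
by rewrite opprD addrACA subrr add0r -scalerBl -rmorphB scalerA -rmorphM /= mulVf ?scale1r//.
Qed.

(** For nonnegative [b] this is lower limit 0, not convergence to 0. *)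
Definition vanishing b := forall e N, 0 < e -> exists2 n, (N <= n)%N & b n < e.

(** Index 0 is left out because the norm estimate for the powers of the operator starts at n = 1. *)
Definition dominated b x :=
  exists C, forall n, (0 < n)%N -> rnorm (iter n T x) <= C * b n.

Lemma dominatedD b x y : dominated b x -> dominated b y -> dominated b (x + y).
Proof.
move=> [C xC] [D yD]; exists (C + D) => n n0.
by rewrite iter_add (le_trans (rnormD _ _))// mulrDl lerD ?xC ?yD.
Qed.

Lemma dominatedZ b t x : dominated b x -> dominated b (t%:C *: x).
Proof.
move=> [C xC]; exists (`|t| * C) => n n0.
by rewrite iter_scale rnormZ -mulrA ler_wpM2l// xC.
Qed.

Lemma dominatedB b x y : dominated b x -> dominated b y -> dominated b (x - y).
Proof.
move=> xb yb; apply: dominatedD => //.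
by have := dominatedZ (-1) yb; rewrite rmorphN /= scaleN1r.
Qed.

Lemma dominated_le b c x : (forall n, 0 <= b n <= c n) ->
  dominated b x -> dominated c x.
Proof.
move=> bc [C xC]; exists `|C| => n n0; have /andP[b0 bcn] := bc n.
by rewrite (le_trans (xC n n0))// (le_trans (ler_wpM2r b0 (ler_norm C)))// ler_wpM2l.
Qed.

(** The sum is at most (|C| + 1) b_n for n > 0, so it is small wherever [b] is: the subsequence
    comes from [b] and not from [x]. *)
Lemma dominated_vanishing b x : (forall n, 0 <= b n) -> vanishing b ->
  dominated b x -> vanishing (fun n => b n + rnorm (iter n T x)).
Proof.
move=> b0 bv [C xC] e N e0.
have C1 : 0 < `|C| + 1 + 1 by rewrite addrC ltr_pwDl// addr_ge0.
have [n] := bv (e / (`|C| + 1 + 1)) (maxn N 1) (divr_gt0 e0 C1).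
rewrite geq_max => /andP[Nn n0]; rewrite ltr_pdivlMr// => be; exists n => //.
apply: le_lt_trans be; have := xC n n0.
have := ler_wpM2r (b0 n) (ler_norm C); have := b0 n; nra.
Qed.

Lemma irregular_suff x : vanishing (fun n => rnorm (iter n T x)) ->
  ~ bounded_orbit x -> irregular T x.
Proof.
move=> xv xN; split; first by apply/limn_einf0P => // n; exact: rnorm_ge0.
apply: unbounded_limn_esup => M; apply: contrapT => /forallNP xM; apply: xN.
by exists M => n; rewrite leNgt; apply/negP/xM.
Qed.

Lemma dominated_irregular b x : (forall n, 0 <= b n) -> vanishing b ->
  dominated b x -> ~ bounded_orbit x -> irregular T x.
Proof.
move=> b0 bv xb; apply: irregular_suff => e N e0.
have [n Nn bxe] := dominated_vanishing b0 bv xb N e0; exists n => //.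
by apply: le_lt_trans bxe; rewrite lerDr.
Qed.

Lemma irregular_not_power_bounded x : irregular T x -> ~ power_bounded T.
Proof.
move=> [_ /limn_esupy_unbounded xunb] /power_boundedP[M TM].
have [n] := xunb (M * rnorm x).
by rewrite ltNge TM.
Qed.

(** Under power-boundedness, an orbit that is once very small stays small, which upgrades lower
    limit 0 to convergence on [E]; density and the uniform bound carry this to every [x]. *)
Lemma power_bounded_cvg0 (E : set X) : dense E ->
  (forall x, E x -> vanishing (fun n => rnorm (iter n T x))) ->
  power_bounded T ->
  forall x, (limn_esup (fun n => (rnorm (iter n T x))%:E) <= 0)%E.
Proof.
move=> /dense_rnormP dE Ev /power_boundedP[M TM] x.
apply: limn_esup_le0 => e e0.
have M1 : 0 < `|M| + 1 by rewrite ltr_wpDl.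
pose d := e / 2 / (`|M| + 1).
have d0 : 0 < d by rewrite !divr_gt0.
have dM : (`|M| + 1) * d = e / 2 by rewrite mulrC divfK// gt_eqF.
have TM1 n z : rnorm z < d -> rnorm (iter n T z) <= e / 2.
  move=> zd; rewrite -dM (le_trans (TM n z))//.
  rewrite (@le_trans _ _ ((`|M| + 1) * rnorm z))//.
    by rewrite ler_wpM2r ?rnorm_ge0//; have := ler_norm M; lra.
  by rewrite ler_wpM2l ?ltW.
have [y Ey xy] := dE x d d0; have [N _ yN] := Ev y Ey d 0%N d0.
exists N => n Nn; have -> : x = (x - y) + y by rewrite subrK.
rewrite iter_add (le_trans (rnormD _ _))// [leRHS]splitr.
apply: lerD; first exact: TM1.
by rewrite -(subnK Nn) iterD TM1.
Qed.

(** * Generic behaviour of the orbits of a bounded operator *)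

Hypothesis bndT : bounded_operator T.

Lemma iter_lipschitz n :
  exists2 C, 0 < C & forall x, rnorm (iter n T x) <= C * rnorm x.
Proof.
have [_ /lty_le_fin[M M0 /(linear_rnorm_le linT) TM]] := bndT.
elim: n => [|n [C C0 TC]]; first by exists 1 => // x; rewrite mul1r.
exists ((M + 1) * C) => [|x /=]; first by rewrite mulr_gt0// ltr_wpDl.
rewrite (le_trans (TM _))// -mulrA (@le_trans _ _ (M * (C * rnorm x)))//.
  by rewrite ler_wpM2l.
by rewrite ler_wpM2r ?lerDl// mulr_ge0 ?rnorm_ge0// ltW.
Qed.

(** Continuity of the norm of the n-th iterate: strict inequalities on it persist on a small
    ball. *)
Lemma iter_near n x e : 0 < e -> exists2 s, 0 < s & forall z, rnorm (x - z) < s ->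
  `|rnorm (iter n T x) - rnorm (iter n T z)| < e.
Proof.
move=> e0; have [C C0 TC] := iter_lipschitz n.
exists (e / C) => [|z]; first exact: divr_gt0.
rewrite ltr_pdivlMr// mulrC => /(le_lt_trans (TC _)); rewrite iter_sub.
apply: le_lt_trans; rewrite ler_norml.
have := rnormD (iter n T x - iter n T z) (iter n T z); rewrite subrK.
have := rnormD (iter n T z - iter n T x) (iter n T x); rewrite subrK.
by rewrite (rnormBC (iter n T z)); lra.
Qed.

(** The Banach-Steinhaus argument: were [M] a bound for all orbits starting in some ball, linearity
    would bound all powers uniformly. So each ball contains a point whose orbit exceeds [M], and
    continuity spreads this to a smaller ball. *)
Lemma nowhere_dense_bounded M : ~ power_bounded T ->
  nowhere_dense (~` [set x | exists n, M < rnorm (iter n T x)]).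
Proof.
move=> Tunb; apply/nowhere_denseP => x e e0.
have [y xy [n My]] : exists2 y, rnorm (x - y) < e &
    exists n, M < rnorm (iter n T y).
  apply: contrapT => /forall2NP bnd; apply: Tunb; apply/power_boundedP.
  have {}bnd y n : rnorm (x - y) < e -> rnorm (iter n T y) <= M.
    by move=> xy; have [//|/forallNP/(_ n)/negP] := bnd y; rewrite -leNgt.
  (* Both x and x + c v lie in the ball when c = e / (2 |v|), so c |T^n v| <= 2 M, which gives the
     constant 4 M / e. *)
  exists (4 * M / e) => n v; have [v0|v0] := eqVneq (rnorm v) 0.
    by rewrite (rnorm_eq0 v0) -(subrr v) iter_sub !subrr rnorm0 mulr0.
  have {}v0 : 0 < rnorm v by rewrite lt_neqAle eq_sym v0 rnorm_ge0.
  pose c := e / 2 / rnorm v.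
  have c0 : 0 < c by rewrite !divr_gt0.
  have : rnorm (iter n T (x + c%:C *: v)) <= M.
    apply: bnd; rewrite opprD addNKr rnormN rnormZ gtr0_norm// divfK ?gt_eqF//.
    lra.
  have : rnorm (iter n T x) <= M by apply: bnd; rewrite subrr rnorm0.
  have := rnormB (iter n T (x + c%:C *: v)) (iter n T x).
  rewrite -iter_sub addrAC subrr add0r iter_scale rnormZ gtr0_norm// => h h1 h2.
  have {h h1 h2} : c * rnorm (iter n T v) <= 2 * M by lra.
  rewrite mulrC -ler_pdivlMr// => /le_trans; apply.
  rewrite /c !invfM !invrK le_eqVlt; apply/orP; left; apply/eqP.
  by field; rewrite !gt_eqF.
have [|s s0 near_y] := @iter_near n y (rnorm (iter n T y) - M).
  by rewrite subr_gt0.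
exists y, s; split => // z /near_y zn; apply; exists n.
by move: zn; rewrite ltr_norml; lra.
Qed.

(** The condition is open by continuity, and every point of the dense set [E] satisfies it. *)
Lemma nowhere_dense_not_small b (E : set X) e N : 0 < e ->
  (forall n, 0 <= b n) -> vanishing b -> dense E -> E `<=` dominated b ->
  nowhere_dense (~` [set x | exists2 n, (N <= n)%N &
                                        b n + rnorm (iter n T x) < e]).
Proof.
move=> e0 b0 bv /dense_rnormP dE Eb; apply/nowhere_denseP => x r r0.
have [y /Eb yb xy] := dE x r r0.
have [n Nn yn] := dominated_vanishing b0 bv yb N e0.
have [|s s0 near_y] := @iter_near n y (e - (b n + rnorm (iter n T y))).
  by rewrite subr_gt0.
exists y, s; split => // z /near_y zn; apply; exists n => //.
by move: zn; rewrite ltr_norml; lra.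
Qed.

Lemma residual_unbounded_vanishing b (E : set X) :
  (forall n, 0 <= b n) -> vanishing b -> dense E -> E `<=` dominated b ->
  ~ power_bounded T ->
  residual [set x | vanishing (fun n => b n + rnorm (iter n T x)) /\
                    ~ bounded_orbit x].
Proof.
move=> b0 bv dE Eb Tunb.
(* Two countable families are interleaved: index 2m+1 asks the orbit to exceed m, index 2m asks for
   a sum below 1/(m+1) at some time k >= m. *)
pose G n := if odd n then [set x | exists k, n./2%:R < rnorm (iter k T x)]
  else [set x | exists2 k, (n./2 <= k)%N &
                           b k + rnorm (iter k T x) < n./2.+1%:R^-1].
apply: (@residual_bigcap _ _ _ G) => [n|x Gx].
  rewrite /G; case: ifP => _; first exact: nowhere_dense_bounded.
  by apply: (nowhere_dense_not_small (E := E)); rewrite ?invr_gt0.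
split=> [e N e0|[M xM]].
  have [m me] := ltr_add_invr e0; rewrite add0r in me.
  have := Gx (maxn N m).*2 I; rewrite /G /= odd_double doubleK => -[k].
  rewrite geq_max => /andP[Nk mk] bk; exists k => //.
  apply: lt_trans bk _; apply: le_lt_trans me.
  by rewrite lef_pV2 ?posrE ?ltr0n// ler_nat ltnS leq_maxr.
have [m Mm] : exists m : nat, M < m%:R.
  by exists (Num.bound `|M|); rewrite (le_lt_trans (ler_norm M))// archi_boundP.
have := Gx m.*2.+1 I; rewrite /G /= odd_double /= uphalf_double => -[k].
by move=> /(lt_trans Mm); rewrite ltNge xM.
Qed.

End Orbits.

(** * Countable exceptional sets and the dense scrambled set *)

Lemma uncountable_setC (R : realType) (B : set R) :
  countable B -> ~ countable (~` B).
Proof.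
move=> cB cCB; have cT : countable [set: R].
  rewrite -(setUv B) -bigcup2E; apply: bigcup_countable => [|n _].
    exact: countableP.
  by rewrite /bigcup2; case: ifP => // _; case: ifP => // _; exact: countable0.
(* A countable real line would make [0,1] a null set. *)
have : lebesgue_measure (`[0%R, 1%R] : set R) = 0%E.
  by apply: countable_lebesgue_measure0; apply: sub_countable cT; exact: subset_card_le.
by rewrite lebesgue_measure_itv /= lte_fin ltr01 sube0 => /eqP; rewrite eqe oner_eq0.
Qed.

Lemma countable_subsingleton (T : Type) (A : set T) :
  (forall x y, A x -> A y -> x = y) -> countable A.
Proof.
move=> A1; apply/countable_injP; exists (fun=> 0%N).
by move=> x y /set_mem Ax /set_mem Ay _; exact: A1.
Qed.

Section DenselyLiYorke.
Local Open Scope complex_scope.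
Variables (R : realType) (X : normedModType R[i]).

(** The sequence returns to each ball at arbitrarily late indices, so it stays dense after a
    perturbation tending to 0. Term n approximates the point of [A] coded by the 2-adic valuation of
    n, and each valuation occurs infinitely often. *)
Lemma separable_dense_seq (E : set X) : separable X -> dense E ->
  exists d : nat -> X, (forall n, E (d n)) /\
    forall x (e : R) N, 0 < e -> exists2 n, (N <= n)%N & rnorm (x - d n) < e.
Proof.
move=> [A /countable_injP[f finj] /dense_rnormP dA] /dense_rnormP dE.
have near_seq n : exists d, E d /\
    forall x, A x -> f x = logn 2 n -> rnorm (x - d) < n.+1%:R^-1.
  have n0 : 0 < n.+1%:R^-1 :> R by rewrite invr_gt0.
  have [[y [Ay fy]]|noA] := pselect (exists y, A y /\ f y = logn 2 n).
    have [d Ed yd] := dE y _ n0; exists d; split => // x Ax fx.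
    by rewrite (finj x y) ?mem_setE ?fx//; exact/mem_set.
  have [d Ed _] := dE 0 _ n0; exists d; split => // x Ax fx.
  by case: noA; exists x.
have [d dP] := choice near_seq; exists d; split => [n|x e N e0].
  by have [] := dP n.
have e2 : 0 < e / 2 by rewrite divr_gt0.
have [y Ay xy] := dA x _ e2.
have [m me] := ltr_add_invr e2; rewrite add0r in me.
(* The odd factor leaves the valuation equal to [f y] and makes n as large as required. *)
pose n := (2 ^ f y * (maxn N m).*2.+1)%N.
have maxn_n : (maxn N m <= n)%N.
  apply: (@leq_trans (maxn N m).*2.+1); last by rewrite leq_pmull// expn_gt0.
  by rewrite -addnn -addnS leq_addr.
have logn_n : logn 2 n = f y.
  rewrite lognM ?expn_gt0// pfactorK// logn_coprime ?addn0//.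
  by rewrite coprime2n /= odd_double.
move: maxn_n; rewrite geq_max => /andP[Nn mn]; exists n => //.
have [_ /(_ y Ay)] := dP n; rewrite logn_n => /(_ erefl) yd.
have : n.+1%:R^-1 <= m.+1%:R^-1 :> R by rewrite lef_pV2 ?posrE ?ltr0n// ler_nat.
have := rnormD (x - y) (y - d n); rewrite subrKA.
by move: n.+1%:R^-1 m.+1%:R^-1 me yd => i j; lra.
Qed.

Variable T : X -> X.
Hypothesis linT : linear T.

(* On a line [u + R x0] with [x0] of unbounded orbit, at most one point has a
   bounded orbit; since the exceptional parameters below are thus countably
   many, a scrambled set can be made both dense (through [p]) and uncountable
   (through the multiples of [x0]). *)
Lemma dense_Li_Yorke (b : nat -> R) (E : set X) (x0 : X) : separable X ->
  (forall n, 0 <= b n) -> vanishing b -> dense E -> E `<=` dominated T b ->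
  dominated T b x0 -> ~ bounded_orbit T x0 -> densely_Li_Yorke_chaotic T.
Proof.
move=> sepX b0 bv dE Eb bx0 ux0.
have [d [Ed dd]] := separable_dense_seq sepX dE.
(* These coefficients are distinct, so differences of the points [p] keep a component along [x0],
   and they tend to 0, so [p] stays dense. *)
pose h n : R := n.+1%:R^-1.
have h_inj n m : n != m -> h n - h m != 0.
  by rewrite subr_eq0; apply: contraNneq => /invr_inj/eqP; rewrite eqr_nat eqSS.
(* The parameters t for which [p n - p m], defined below, would have a bounded orbit; at most one
   for each pair. *)
pose bad n m := [set t : R | n != m /\
  bounded_orbit T (d n - d m + t%:C *: ((h n - h m)%:C *: x0))].
have bigcupC (F : nat -> set R) :
    (forall n, countable (F n)) -> countable (\bigcup_n F n).
  by move=> cF; apply: bigcup_countable => [|n _]; [exact: countableP | exact: cF].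
have cbad : countable (\bigcup_n \bigcup_m bad n m).
  apply: (bigcupC _) => n; apply: (bigcupC _) => m.
  apply: countable_subsingleton => s t [nm bs] [_ bt].
  apply: bounded_orbit_line bs bt => //.
  move=> /(bounded_orbitZ linT (h n - h m)^-1).
  by rewrite scalerA -rmorphM /= mulVf ?h_inj// scale1r.
have [t tgood] : exists t, ~ (\bigcup_n \bigcup_m bad n m) t.
  apply/existsNP => badT; apply: (uncountable_setC cbad).
  apply: sub_countable (countable0 R); apply: subset_card_le => x; apply.
  exact: badT.
pose p n := d n + (t * h n)%:C *: x0.
have up n m : n <> m -> ~ bounded_orbit T (p n - p m).
  move=> /eqP nm bnm; apply: tgood; exists n => //; exists m => //; split => //.
  move: bnm; rewrite /p opprD addrACA -scalerBl -rmorphB /= -mulrBr.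
  by rewrite scalerA -rmorphM.
pose bad' n := [set t : R | bounded_orbit T (- p n + t%:C *: x0)].
have cbad' : countable (\bigcup_n bad' n).
  apply: (bigcupC _) => n; apply: countable_subsingleton => r s.
  exact: bounded_orbit_line.
pose S := range p `|` [set s%:C *: x0 | s in ~` \bigcup_n bad' n].
(* With u = - r x0 both points of the line are 0, whose orbit is bounded. *)
have inj_x0 r s : r%:C *: x0 = s%:C *: x0 -> r = s.
  move=> rs; apply: (bounded_orbit_line linT (u := - (r%:C *: x0)) ux0).
    by rewrite addNr; exact: bounded_orbit0.
  by rewrite rs addNr; exact: bounded_orbit0.
have bp n : dominated T b (p n).
  by apply: (dominatedD linT _ (dominatedZ linT _ bx0)); exact/Eb/Ed.
have bS x : S x -> dominated T b x.
  by move=> [[n _ <-]|[s _ <-]]; [exact: bp | exact: dominatedZ].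
have uS x y : S x -> S y -> x <> y -> ~ bounded_orbit T (x - y).
  have unbC z : bounded_orbit T (- z) -> bounded_orbit T z.
    by move=> /(bounded_orbitB linT (bounded_orbit0 linT)); rewrite sub0r opprK.
  move=> [[n _ <-]|[r rgood <-]] [[m _ <-]|[s sgood <-]] xy.
  - by apply: up => nm; apply: xy; rewrite nm.
  - move=> bnd; apply: sgood; exists n => //.
    by apply: unbC; rewrite opprD opprK.
  - by move=> bnd; apply: rgood; exists m => //; rewrite /bad' /= addrC.
  - rewrite -scalerBl -rmorphB => /(bounded_orbitZ linT (r - s)^-1).
    rewrite scalerA -rmorphM /= mulVf ?scale1r// subr_eq0.
    by apply/eqP => rs; apply: xy; rewrite rs.
exists S; first split.
- move=> /countable_injP[f finj]; apply: (uncountable_setC cbad').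
  apply/countable_injP; exists (fun s => f (s%:C *: x0)) => r s rgood sgood.
  by move=> /finj frs; apply/inj_x0/frs; apply/mem_set; right; [exists r|exists s] => //;
    exact: set_mem.
- move=> x y Sx Sy xy.
  under [in limn_einf _]eq_fun do rewrite -iter_sub//.
  under [in limn_esup _]eq_fun do rewrite -iter_sub//.
  have xyb := dominatedB linT (bS x Sx) (bS y Sy).
  by have [-> ->] := dominated_irregular b0 bv xyb (uS x y Sx Sy xy).
- apply/dense_rnormP => x e e0.
  have e2 : 0 < e / 2 by rewrite divr_gt0.
  (* The added 1 makes [c] positive, so that one can divide by it even when t = 0. *)
  pose c := `|t| * rnorm x0 + 1.
  have c0 : 0 < c by rewrite ltr_wpDl// mulr_ge0// rnorm_ge0.
  have [N Ne] := ltr_add_invr (divr_gt0 e2 c0); rewrite add0r in Ne.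
  have [n Nn xd] := dd x _ N e2.
  exists (p n); first by left; exists n.
  rewrite /p opprD addrA (le_lt_trans (rnormB _ _))// rnormZ [ltRHS]splitr.
  apply: ltrD => //; apply: (@le_lt_trans _ _ (c * N.+1%:R^-1)); last first.
    by rewrite mulrC -ltr_pdivlMr.
  rewrite normrM -mulrA [`|h n| * _]mulrC mulrA.
  apply: ler_pM; rewrite ?mulr_ge0 ?rnorm_ge0// ?lerDl//.
  rewrite ger0_norm ?invr_ge0// lef_pV2 ?posrE ?ltr0n// ler_nat//.
Qed.

End DenselyLiYorke.

(** * The equivalences for weighted composition operators *)

Theorem theorem4 (R : realType) (X : completeNormedModType R[i])
    (ev : X -> R[i] -> R[i])
    (X_analytic : space_of_analytic_functions ev)
    (X_infinite_dim : ~ finite_dimensional X)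
    (X_separable : separable X)
    (Hinf_in_X : forall f : R[i] -> R[i], Hinf f -> in_space ev f)
    (Hinf_dense : dense [set x : X | Hinf (ev x)])
    (wcomp_bounded : forall psi u : R[i] -> R[i],
       analytic_self_map psi -> Hinf u ->
       [/\ forall x : X, in_space ev (weighted_comp u psi (ev x)),
           bounded_operator (weighted_comp_op ev u psi)
         & forall (f : R[i] -> R[i]) (n : nat), Hinf f -> (0 < n)%N ->
             rnorm (iter n (weighted_comp_op ev u psi) (elt ev f))
               <= rnorm (elt ev (weight_iter u psi n)) * sup_norm f])
    (phi w : R[i] -> R[i])
    (phi_self_map : analytic_self_map phi)
    (w_Hinf : Hinf w)
    (w_liminf : limn_einf
       (fun n => (rnorm (elt ev (weight_iter w phi n)))%:E) = 0%E) :
  let T := weighted_comp_op ev w phi in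
  (densely_Li_Yorke_chaotic T <-> residual [set x : X | irregular T x]) /\
  (residual [set x : X | irregular T x] <-> ~ power_bounded T).
Proof.
move=> T.
have [_ ev_inj _] := X_analytic.
have [_ Tbnd Tpow] := wcomp_bounded phi w phi_self_map w_Hinf.
have linT : linear T := proj1 Tbnd.
pose b n := rnorm (elt ev (weight_iter w phi n)).
have b0 n : 0 <= b n by exact: rnorm_ge0.
have bv : vanishing b by apply/(limn_einf0P b0).
pose E := [set x : X | Hinf (ev x)].
have Eb : E `<=` dominated T b.
  move=> x Ex; exists (sup_norm (ev x)) => n n0.
  (* Injectivity of [ev] leaves [x] as the only element representing [ev x]. *)
  suff {1}<- : elt ev (ev x) = x by rewrite mulrC; exact: Tpow.
  apply: xget_subset1 => // y z /= yx zx; apply: ev_inj => v v1.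
  by rewrite yx// zx.
have Ev x : E x -> vanishing (fun n => rnorm (iter n T x)).
  move=> /Eb xb e N e0.
  have [n Nn ne] := dominated_vanishing b0 bv xb N e0; exists n => //.
  by apply: le_lt_trans ne; rewrite lerDr.
have LY_npb : densely_Li_Yorke_chaotic T -> ~ power_bounded T.
  move=> [S [Suncount Sscr] _] pb; apply: Suncount.
  (* Two distinct points of [S] would need a positive upper limit, while all orbits tend to 0; so
     [S] has at most one point. *)
  apply: countable_subsingleton => x y Sx Sy; apply: contrapT => xy.
  have [_] := Sscr x y Sx Sy xy; apply/negP; rewrite -leNgt.
  under eq_fun do rewrite -iter_sub//.
  exact: (power_bounded_cvg0 linT Hinf_dense Ev pb).
have res_npb : residual [set x : X | irregular T x] -> ~ power_bounded T.
  by move=> /residual_nonempty[x /(irregular_not_power_bounded linT)].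
have npb_good := residual_unbounded_vanishing linT Tbnd b0 bv Hinf_dense Eb.
have npb_res : ~ power_bounded T -> residual [set x : X | irregular T x].
  move=> /npb_good/residual_sub; apply => x [xv ux].
  apply: irregular_suff => // e N e0; have [n Nn ne] := xv e N e0.
  by exists n => //; apply: le_lt_trans ne; rewrite lerDr.
have npb_LY : ~ power_bounded T -> densely_Li_Yorke_chaotic T.
  move=> /npb_good/residual_nonempty[x0 [x0v ux0]].
  (* Enlarging [b] by the orbit of [x0] makes [x0] dominated too, and [c] still has lower limit 0 by
     the choice of [x0]; thus [E] and [x0] share one subsequence. *)
  pose c n := b n + rnorm (iter n T x0).
  have bc n : 0 <= b n <= c n by rewrite b0 lerDl rnorm_ge0.
  apply: (dense_Li_Yorke linT (b := c) X_separable _ x0v Hinf_dense _ _ ux0).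
  - by move=> n; have /andP[/le_trans] := bc n; apply.
  - by move=> x /Eb; exact: dominated_le.
  - by exists 1 => n _; rewrite mul1r lerDr.
by split; split; auto.
Qed.
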